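(* Let $r \geq 1$ and $d \geq 1$ be integers, and let $G$ be a graph on $n$ vertices satisfying the $(r+d+1)$-strong neighbourhood property. Let $\Delta$ denote the maximum degree of a vertex in $G$, and assume $\Delta \geq 2$. Let $\theta_n = \theta_n(G,r,d)$ be the minimum size of an identification code of $G$ with index $r$. Then \[ \frac{1}{\Delta+1} \leq \frac{\theta_n}{n} \leq 1-\frac{c(d,r)}{(\Delta+1)^{(r+2)/d}}, \qquad\text{where } c(d,r) := d\,(d+1)^{-1-1/d}\,(2r)^{-1/d}. \]
   Context: All graphs are finite and simple, with vertex set $V=\{1,\dots,n\}$. For a vertex $v$, $N(v)$ is the set of vertices adjacent to $v$ (not including $v$), and $N[v] = N(v)\cup\{v\}$. For a set $A$, $\#A$ denotes its cardinality. A set of vertices $\mathcal{C}$ is an identification code for $G$ with index $r$ if for any two distinct vertices $u,v$ of $G$, $\#\big((N[v]\setminus N[u])\cap \mathcal{C}\big) \geq r$. For an integer $k\ge 1$, $G$ has the $k$-strong neighbourhood property if for any two distinct vertices $u,v$ of $G$, $\#\big(N[v]\setminus N[u]\big) \geq k$. *)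

(* Defs.v *)
From mathcomp Require Import all_boot all_order all_algebra.
From mathcomp Require Import reals exp.

Set Implicit Arguments.
Unset Strict Implicit.
Unset Printing Implicit Defensive.

Record sgraph (n : nat) := SGraph {
  adj :> rel 'I_n;
  adj_sym : symmetric adj;
  adj_irrefl : irreflexive adj
}.

Section Graph.
Variables (n : nat) (G : sgraph n).

Definition nbh (v : 'I_n) : {set 'I_n} := [set u | G v u].

Definition cnbh (v : 'I_n) : {set 'I_n} := v |: nbh v.

Definition maxdeg : nat := \max_(v < n) #|nbh v|.

Definition id_code (r : nat) (C : {set 'I_n}) : bool :=
  [forall u, forall v, (u != v) ==> (r <= #|(cnbh v :\: cnbh u) :&: C|)].

Definition strong_nbh (k : nat) : Prop :=
  forall u v : 'I_n, u != v -> k <= #|cnbh v :\: cnbh u|.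

(* The default [set: 'I_n] is itself a code of index r as soon as any code of
   index r exists, so this is the true minimum in that case. *)
Definition min_id_code (r : nat) : nat :=
  #|[arg min_(C < [set: 'I_n] | id_code r C) #|C|]|.

Lemma strong_nbh_id_codeT (r k : nat) :
  r <= k -> strong_nbh k -> id_code r [set: 'I_n].
Proof.
move=> rk sG; apply/forallP => u; apply/forallP => v; apply/implyP => uv.
by rewrite setIT (leq_trans rk) ?sG.
Qed.

Lemma min_id_codeP (r : nat) (C : {set 'I_n}) : id_code r C ->
  (exists2 D, id_code r D & #|D| = min_id_code r) /\
  (forall D, id_code r D -> min_id_code r <= #|D|).
Proof.
move=> cC; rewrite /min_id_code; case: arg_minnP => [|D cD minD].
  apply/forallP => u; apply/forallP => v; apply/implyP => uv.
  move/forallP/(_ u)/forallP/(_ v)/implyP/(_ uv): cC => /leq_trans; apply.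
  by rewrite setIT subset_leq_card ?subsetIl.
by split=> //; exists D.
Qed.

End Graph.

Local Open Scope ring_scope.

Definition cst_dr (R : realType) (d r : nat) : R :=
  d%:R * d.+1%:R `^ (- 1 - d%:R^-1) * (2 * r)%:R `^ (- d%:R^-1).

(* Main.v *)
(** Lower bound: a code meets every closed neighbourhood, and each of its
    vertices lies in at most [Delta + 1] of them.

    Upper bound, by alteration: leave each vertex out of the code independently
    with probability [p].  Only pairs [(u, v)] whose closed neighbourhoods meet
    matter, and there are at most [n (Delta + 1)^2] of them; such a pair is bad
    when fewer than [r] vertices of [N[v] \ N[u]] are kept, which happens with
    probability at most [(Delta + 1)^(r-1) p^(d+2)].  Putting back [r] vertices
    for each bad pair yields a code, so on average at least
    [n (p - A p^(d+1))] vertices stay out, with [A = 2 r (Delta + 1)^(r+2)].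
    The bound is the value at the maximiser [p = (A (d+1))^(-1/d)]. *)

Require Import Defs.
From mathcomp Require Import all_boot all_order all_algebra.
From mathcomp Require Import reals exp.
From mathcomp Require Import ring lra zify.

Set Implicit Arguments.
Unset Strict Implicit.
Unset Printing Implicit Defensive.

Import Order.TTheory GRing.Theory Num.Theory.

(** * Subset counting and binomial bounds *)

Lemma exists_subset_card (T : finType) (A : {set T}) (m : nat) :
  m <= #|A| -> exists2 B : {set T}, B \subset A & #|B| = m.
Proof.
rewrite -bin_gt0 -cards_draws => /card_gt0P[B].
by rewrite inE => /andP[BA /eqP Bm]; exists B.
Qed.

Lemma card_bigcup_leq (I T : finType) (P : pred I) (F : I -> {set T}) :
  #|\bigcup_(i | P i) F i| <= \sum_(i | P i) #|F i|.
Proof.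
elim/big_rec2: _ => [|i k A _ kA]; first by rewrite cards0.
by rewrite (leq_trans (leq_card_setU _ _)) // leq_add2l.
Qed.

Lemma ffact_leq_exp (k m : nat) : k ^_ m <= k ^ m.
Proof.
elim: m k => // m IH [|k]; first by rewrite ffact0n.
rewrite ffactSS expnS leq_mul2l (leq_trans (IH k)) ?orbT //.
by case: m {IH} => // m; rewrite leq_exp2r.
Qed.

Lemma bin_leq_exp (k m : nat) : 'C(k, m) <= k ^ m.
Proof.
apply: leq_trans (ffact_leq_exp k m).
by rewrite -bin_ffact leq_pmulr ?fact_gt0.
Qed.

(** * Independent random subsets of a finite set *)

Section RandomSubset.
Variables (R : realFieldType) (T : finType) (p : R).
Local Open Scope ring_scope.

(** The probability of drawing exactly [X] when each element is drawn independently with probability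
    [p]. *)
Definition subset_weight (X : {set T}) : R :=
  \prod_i (if i \in X then p else 1 - p).

Lemma subset_weight_ge0 (X : {set T}) :
  0 <= p <= 1 -> 0 <= subset_weight X.
Proof.
by move=> p01; apply: prodr_ge0 => i _; case: ifP => _; lra.
Qed.

(** Distributing a product with factor [p + 0] on [A] and [p + (1 - p)] off [A] gives a sum over all
    [X], in which those missing an element of [A] vanish. *)
Lemma sum_subset_weight_sup (A : {set T}) :
  \sum_(X : {set T}) subset_weight X * (A \subset X)%:R = p ^+ #|A|.
Proof.
transitivity (\prod_(i : T) (p + (if i \in A then 0 else 1 - p))).
  rewrite bigA_distr; apply: eq_bigr => X _.
  have [AX|/subsetPn[x xA xX]] := boolP (A \subset X).
    rewrite mulr1; apply: eq_bigr => i _; case: ifPn => // iX.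
    by rewrite ifN //; apply: contra iX; apply/subsetP.
  by rewrite mulr0 [RHS](bigD1 x) //= (negPf xX) xA mul0r.
rewrite (bigID (mem A)) /= [X in _ * X]big1 ?mulr1.
  under eq_bigr => i iA do rewrite iA addr0.
  by rewrite prodr_const.
by move=> i /negPf ->; rewrite subrKC.
Qed.

Lemma sum_subset_weight : \sum_(X : {set T}) subset_weight X = 1.
Proof.
rewrite -[RHS](expr0 p) -(cards0 T) -sum_subset_weight_sup.
by apply: eq_bigr => X _; rewrite sub0set mulr1.
Qed.

(** Linearity of expectation: [#|X|] is a sum of singleton indicators, each of mean [p]. *)
Lemma sum_subset_weight_card :
  \sum_(X : {set T}) subset_weight X * #|X|%:R = #|T|%:R * p.
Proof.
transitivity (\sum_(X : {set T}) \sum_(i : T)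
    subset_weight X * ([set i] \subset X)%:R).
  apply: eq_bigr => X _; rewrite -mulr_sumr; congr (_ * _).
  rewrite -sum1_card natr_sum big_mkcond /=; apply: eq_bigr => i _.
  by rewrite sub1set; case: (i \in X).
rewrite exchange_big /=; under eq_bigr => i _.
  rewrite sum_subset_weight_sup cards1 expr1; over.
by rewrite sumr_const mulr_natl.
Qed.

(** Union bound: if [X] misses at most [m] elements of [D], it contains some subset of [D] of size
    [#|D| - m], and each such subset is contained with probability [p ^+ (#|D| - m)]. *)
Lemma sum_subset_weight_few (D : {set T}) (m : nat) : 0 <= p <= 1 ->
  (m < #|D|)%N ->
  \sum_(X : {set T}) subset_weight X * (#|D :\: X| <= m)%N%:R
    <= 'C(#|D|, m)%:R * p ^+ (#|D| - m).
Proof.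
move=> p01 mD; set k := (#|D| - m)%N.
rewrite -bin_sub 1?ltnW // -/k -cards_draws.
set Q := [set A | _].
apply: (@le_trans _ _ (\sum_(X : {set T}) \sum_(A in Q)
    subset_weight X * (A \subset X)%:R)).
  apply: ler_sum => X _; rewrite -mulr_sumr.
  apply: ler_wpM2l; first exact: subset_weight_ge0.
  case: leqP => [few|_]; last by apply: sumr_ge0 => A _; rewrite ler0n.
  have : (k <= #|D :&: X|)%N by have := cardsID X D; rewrite /k; lia.
  case/exists_subset_card => A; rewrite subsetI => /andP[AD AX] Ak.
  rewrite (bigD1 A) /=; last by rewrite inE AD Ak eqxx.
  by rewrite AX lerDl; apply: sumr_ge0 => B _; rewrite ler0n.
rewrite exchange_big /=; under eq_bigr => A.
  rewrite inE => /andP[_ /eqP Ak].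
  rewrite sum_subset_weight_sup Ak; over.
by rewrite sumr_const mulr_natl.
Qed.

End RandomSubset.

(** * Closed neighbourhoods, bad pairs and the alteration argument *)

Section Codes.
Variables (n : nat) (G : sgraph n).

Lemma cnbh_sym (u v : 'I_n) : (u \in cnbh G v) = (v \in cnbh G u).
Proof. by rewrite !inE eq_sym adj_sym. Qed.

Lemma card_cnbh_leq (v : 'I_n) : #|cnbh G v| <= maxdeg G + 1.
Proof.
rewrite cardsU1 inE adj_irrefl addnC leq_add2r.
by rewrite /maxdeg (bigD1 v) //= leq_maxl.
Qed.

Lemma maxdeg_ltn : 0 < maxdeg G -> maxdeg G < n.
Proof.
case: n G => [|m] H; first by rewrite /maxdeg big_ord0.
move=> _; rewrite ltnS; apply/bigmax_leqP => v _.
rewrite -ltnS -[X in _ < X]card_ord -cardsT.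
apply: proper_card; apply/properP; split; first exact: subsetT.
by exists v; rewrite ?inE ?adj_irrefl.
Qed.

Lemma leq_mul_card_id_code (r : nat) (C : {set 'I_n}) :
  0 < r -> 1 < n -> id_code G r C -> n <= #|C| * (maxdeg G + 1).
Proof.
move=> r0 n1 cC.
have meet v : 0 < #|cnbh G v :&: C|.
  have /card_gt0P[u] : 0 < #|[set~ v]| by rewrite cardsC1 card_ord; lia.
  rewrite !inE => uv.
  move/forallP/(_ u)/forallP/(_ v)/implyP/(_ uv): cC => /(leq_trans r0).
  by move/leq_trans; apply; rewrite subset_leq_card ?setSI ?subsetDl.
have cover : n <= #|\bigcup_(c in C) cnbh G c|.
  rewrite -[leqLHS]card_ord -cardsT; apply/subset_leq_card/subsetP => v _.
  apply/bigcupP.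
  have /card_gt0P[c] := meet v; rewrite inE => /andP[cv Cc].
  by exists c => //; rewrite cnbh_sym.
apply: leq_trans cover (leq_trans (card_bigcup_leq _ _) _).
by rewrite -sum_nat_const leq_sum // => c _; apply: card_cnbh_leq.
Qed.

Definition close_pairs : {set 'I_n * 'I_n} :=
  [set b | (b.1 != b.2) && (cnbh G b.1 :&: cnbh G b.2 != set0)].

Definition bad_pairs (r : nat) (X : {set 'I_n}) : {set 'I_n * 'I_n} :=
  [set b in close_pairs | #|(cnbh G b.2 :\: cnbh G b.1) :\: X| < r].

(** A close pair lies in the square of the closed neighbourhood of any common element [w], and there
    are [n] choices of [w]. *)
Lemma card_close_pairs_leq : #|close_pairs| <= n * (maxdeg G + 1) ^ 2.
Proof.
apply: (@leq_trans #|\bigcup_(w : 'I_n) setX (cnbh G w) (cnbh G w)|).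
  apply/subset_leq_card/subsetP => -[u v]; rewrite inE => /andP[_ /=].
  case/set0Pn => w; rewrite inE => /andP[wu wv].
  by apply/bigcupP; exists w => //; rewrite inE /= !(cnbh_sym _ w) wu wv.
apply: leq_trans (card_bigcup_leq _ _) _.
rewrite -[X in X * _]card_ord -sum_nat_const leq_sum // => w _.
by rewrite cardsX leq_mul ?card_cnbh_leq.
Qed.

(* A pair with disjoint closed neighbourhoods is handled by replacing [u] with
   a neighbour of [v], which only shrinks [N[v] \ N[u]]. *)
Lemma id_code_close (r : nat) (C : {set 'I_n}) : strong_nbh G 2 ->
  (forall u v, (u, v) \in close_pairs ->
     r <= #|(cnbh G v :\: cnbh G u) :&: C|) ->
  id_code G r C.
Proof.
move=> sG hC; apply/forallP => u; apply/forallP => v; apply/implyP => uv.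
have [disj|meet] := boolP (cnbh G u :&: cnbh G v == set0); last first.
  by apply: hC; rewrite inE /= uv.
(* At least two elements in [N[v] \ N[u]] force [v] to have a neighbour [w]; the pair [(w, v)] is
   close because both closed neighbourhoods contain [v]. *)
have : 0 < #|nbh G v|.
  have := leq_trans (sG _ _ uv) (subset_leq_card (subsetDl _ _)).
  by rewrite cardsU1 inE adj_irrefl add1n ltnS.
case/card_gt0P => w; rewrite inE => vw.
have : (w, v) \in close_pairs.
  rewrite inE /=; apply/andP; split.
    by apply: contraTneq vw => ->; rewrite adj_irrefl.
  by apply/set0Pn; exists v; rewrite !inE adj_sym vw eqxx orbT.
move/hC/leq_trans; apply; apply/subset_leq_card/setSI.
have -> : cnbh G v :\: cnbh G u = cnbh G v.
  by apply/setDidPl; rewrite disjoint_sym -setI_eq0.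
exact: subsetDl.
Qed.

Lemma min_id_code_alteration (r : nat) (X : {set 'I_n}) :
  0 < r -> strong_nbh G r.+1 ->
  min_id_code G r + #|X| <= n + r * #|bad_pairs r X|.
Proof.
move=> r0 sG.
have [f fP] : exists f : 'I_n * 'I_n -> {set 'I_n}, forall b,
    b.1 != b.2 -> f b \subset cnbh G b.2 :\: cnbh G b.1 /\ #|f b| = r.
  apply: (@fin_all_exists _ (fun=> {set 'I_n})
    (fun b S => b.1 != b.2 -> S \subset cnbh G b.2 :\: cnbh G b.1 /\ #|S| = r)).
  move=> b.
  (* On the diagonal nothing is required of [f], and the empty set is a default. *)
  have [->|bb] := eqVneq b.1 b.2; first by exists set0.
  have [S SD Sr] := exists_subset_card (ltnW (sG _ _ bb)).
  by exists S.
set U := \bigcup_(b in bad_pairs r X) f b.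
have badP b : b \in bad_pairs r X -> b.1 != b.2.
  by rewrite !inE => /andP[/andP[]].
have cU : #|U| <= r * #|bad_pairs r X|.
  apply: leq_trans (card_bigcup_leq _ _) _.
  rewrite mulnC -sum_nat_const leq_sum // => b /badP /fP[_ ->] //.
have code : id_code G r (~: X :|: U).
  apply: id_code_close => [u v uv|u v uv].
    by apply: leq_trans (sG _ _ uv); rewrite ltnS.
  have [bad|] := boolP ((u, v) \in bad_pairs r X).
    have [/= fD fr] := fP _ (badP _ bad).
    rewrite -fr; apply: subset_leq_card; rewrite subsetI fD /=.
    by apply: subsetU; rewrite (bigcup_sup (u, v)) ?orbT.
  rewrite inE uv /= -leqNgt => /leq_trans; apply.
  by rewrite setDE; apply/subset_leq_card/setIS/subsetUl.
have [_ minC] := min_id_codeP code.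
have := minC _ code.
have [+ _] := leq_card_setU (~: X) U; have := cardsC X; rewrite card_ord; lia.
Qed.

(** The tail bound is used with [m = r.-1]. There [#|D| <= M] bounds the binomial by [M ^ r.-1], and
    [#|D| >= r + d + 1] leaves an exponent of at least [d + 2] on [p]. The number of close pairs
    supplies the factor [n * M ^ 2]. *)
Lemma sum_subset_weight_bad (R : realFieldType) (p : R) (r d : nat) :
  (0 <= p <= 1)%R -> 0 < r -> strong_nbh G (r + d + 1) ->
  (\sum_(X : {set 'I_n}) subset_weight p X * #|bad_pairs r X|%:R
    <= n%:R * (maxdeg G + 1)%:R ^+ r.+1 * p ^+ d.+2)%R.
Proof.
move=> p01 r0 sG.
set M := (maxdeg G + 1)%N.
apply: (@le_trans _ _
    (\sum_(b in close_pairs) (M%:R ^+ r.-1 * p ^+ d.+2))%R); last first.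
  rewrite sumr_const -[leLHS]mulr_natl mulrA; apply: ler_wpM2r.
    by apply: exprn_ge0; case/andP: p01.
  have -> : r.+1 = 2 + r.-1 by lia.
  rewrite exprD mulrA; apply: ler_wpM2r; first exact/exprn_ge0/ler0n.
  by rewrite -natrX -natrM ler_nat card_close_pairs_leq.
apply: (@le_trans _ _
    (\sum_(X : {set 'I_n}) \sum_(b in close_pairs) subset_weight p X *
    (#|(cnbh G b.2 :\: cnbh G b.1) :\: X| <= r.-1)%N%:R)%R).
  apply: ler_sum => X _; rewrite -mulr_sumr.
  apply: ler_wpM2l; first exact: subset_weight_ge0.
  rewrite -sum1_card natr_sum big_mkcond [leRHS]big_mkcond /=.
  apply: ler_sum => b _; rewrite inE; case: ifP => [/andP[-> few]|_].
    by rewrite -ltnS prednK // few.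
  by case: ifP => // _; rewrite ler0n.
rewrite exchange_big /=; apply: ler_sum => b; rewrite inE => /andP[bb _].
have kD := sG _ _ bb; set D := _ :\: _ in kD *.
have DM : #|D| <= M.
  exact: leq_trans (subset_leq_card (subsetDl _ _)) (card_cnbh_leq _).
apply: le_trans (sum_subset_weight_few p01 _) _; first by lia.
apply: ler_pM; rewrite ?ler0n ?exprn_ge0 //; try by case/andP: p01.
  rewrite -natrX ler_nat (leq_trans (bin_leq_exp _ _)) //.
  by case: r.-1 => // m; rewrite leq_exp2r.
by case/andP: p01 => p0 p1; apply: ler_wiXn2l => //; lia.
Qed.

(** The alteration inequality holds for every [X]; it is averaged against weights of total 1, under
    which [#|X|] has mean [n * p]. *)
Lemma min_id_code_expected (R : realFieldType) (p : R) (r d : nat) :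
  (0 <= p <= 1)%R -> 0 < r -> strong_nbh G (r + d + 1) ->
  ((min_id_code G r)%:R <= n%:R *
    (1 - (p - r%:R * (maxdeg G + 1)%:R ^+ r.+1 * p ^+ d.+2)))%R.
Proof.
move=> p01 r0 sG.
have sG1 : strong_nbh G r.+1.
  by move=> u v uv; apply: leq_trans (sG _ _ uv); lia.
have := sum_subset_weight_bad p01 r0 sG.
set B := (\sum_X _)%R => leB.
suff : ((min_id_code G r)%:R + n%:R * p <= n%:R + r%:R * B)%R.
  have := ler_wpM2l (ler0n R r) leB; set q := (p ^+ _)%R.
  by set M := (_ ^+ _)%R; nra.
rewrite -[X in (_ + X%:R * p <= _)%R]card_ord -sum_subset_weight_card.
have avg (c : R) : c = (\sum_(X : {set 'I_n}) c * subset_weight p X)%R.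
  by rewrite -mulr_sumr sum_subset_weight mulr1.
rewrite [X in (X + _ <= _)%R]avg [X in (_ <= X + _)%R]avg.
rewrite /B mulr_sumr -!big_split /=.
apply: ler_sum => X _.
have : ((min_id_code G r + #|X|)%:R <= (n + r * #|bad_pairs r X|)%:R :> R)%R.
  by rewrite ler_nat min_id_code_alteration.
rewrite !natrD natrM => /(ler_wpM2l (subset_weight_ge0 X p01)).
by set w := subset_weight p X; lra.
Qed.

End Codes.

(** * Choice of the probability and the final bounds *)

Local Open Scope ring_scope.

Lemma root_exp (R : realType) (d : nat) (x : R) : (0 < d)%N -> 0 <= x ->
  (x `^ d%:R^-1) ^+ d = x.
Proof.
move=> d0 x0; rewrite -powR_mulrn ?powR_ge0 // -powRrM mulVf ?powRr1 //.
by rewrite pnatr_eq0 -lt0n.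
Qed.

(** The right-hand side is [d / (d + 1)] times the maximiser [p], which is the maximum of
    [p - A p^(d+1)]. *)
Lemma cst_drE (R : realType) (r d M : nat) : (0 < d)%N -> (0 < M)%N ->
  cst_dr R d r / M%:R `^ ((r + 2)%:R / d%:R) =
  d%:R / d.+1%:R *
    (((2 * r)%:R * M%:R ^+ (r + 2) * d.+1%:R) `^ d%:R^-1)^-1.
Proof.
move=> d0 M0; rewrite /cst_dr powRD ?powR_inv1 ?ler0n //; last first.
  by rewrite pnatr_eq0 implybT.
rewrite !powRN powRrM powR_mulrn ?ler0n //.
rewrite !powRM ?mulr_ge0 ?exprn_ge0 ?ler0n // !invfM; ring.
Qed.

Theorem theorem1 (R : realType) (n r d : nat) (G : sgraph n)
  (r_ge1 : (1 <= r)%N) (d_ge1 : (1 <= d)%N)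
  (G_strong : strong_nbh G (r + d + 1)%N)
  (Delta_ge2 : (2 <= maxdeg G)%N) :
  1 / (maxdeg G + 1)%:R <= (min_id_code G r)%:R / n%:R :> R /\
  (min_id_code G r)%:R / n%:R <=
    1 - cst_dr R d r / (maxdeg G + 1)%:R `^ ((r + 2)%:R / d%:R) :> R.
Proof.
have n2 : (1 < n)%N by have := @maxdeg_ltn n G; lia.
have n0 : 0 < n%:R :> R by rewrite ltr0n ltnW.
have M0n : (0 < maxdeg G + 1)%N by rewrite addn1.
have M0 : 0 < (maxdeg G + 1)%:R :> R by rewrite ltr0n.
split.
  have /min_id_codeP[[C cC <-] _] : id_code G r setT.
    by apply: strong_nbh_id_codeT G_strong; lia.
  rewrite ler_pdivlMr // mulrAC ler_pdivrMr // mul1r -natrM ler_nat.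
  exact: leq_mul_card_id_code cC.
rewrite cst_drE // ler_pdivrMr // mulrC.
set M : R := (maxdeg G + 1)%:R in M0 *.
have M1 : 1 <= M by rewrite ler1n.
set A := (2 * r)%:R * M ^+ (r + 2).
have A0 : 0 < A by rewrite mulr_gt0 ?exprn_gt0 // ltr0n muln_gt0.
(* This makes [q >= 1], so that [q^-1], the maximiser, is a legitimate probability. *)
have Ad1 : 1 <= A * d.+1%:R.
  by rewrite !mulr_ege1 ?exprn_ege1 ?ler1n ?muln_gt0.
set q := (A * d.+1%:R) `^ d%:R^-1.
have q1 : 1 <= q by rewrite -(powRr0 (A * d.+1%:R)) ler_powR ?invr_ge0 ?ler0n.
have q0 : 0 < q by apply: lt_le_trans q1.
have p01 : 0 <= q^-1 <= 1 by rewrite invr_ge0 ltW //= invf_le1.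
apply: le_trans (min_id_code_expected p01 r_ge1 G_strong) _.
rewrite ler_pM2l // lerD2l lerN2.
(* With [p = q^-1], [p ^+ d] is [1 / (A * (d + 1))], so [p - A p^(d+1)] equals
   [p * (1 - 1 / (d + 1))]. *)
have pd : q^-1 ^+ d.+1 = q^-1 / (A * d.+1%:R).
  by rewrite exprS exprVn root_exp // ltW // (lt_le_trans ltr01).
have -> : d%:R / d.+1%:R * q^-1 = q^-1 - A * q^-1 ^+ d.+1.
  rewrite pd -[d.+1]addn1 natrD.
  have d1 : 0 < d%:R + 1 :> R by rewrite ltr_wpDl ?ler0n.
  by field; rewrite !gt_eqF.
(* The expected bound is relaxed factor by factor to [A p^(d+1)]: [r <= 2 * r], one more power of
   [M >= 1], and one power of [p <= 1] fewer. *)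
rewrite lerD2l lerN2; apply: ler_pM.
- by rewrite mulr_ge0 ?exprn_ge0 ?ler0n // ltW.
- by rewrite exprn_ge0 ?invr_ge0 ?ltW.
- apply: ler_pM; rewrite ?ler0n ?exprn_ge0 ?(ltW M0) //.
    by rewrite ler_nat leq_pmull.
  by apply: ler_weXn2l => //; lia.
- by case/andP: p01 => ? ?; apply: ler_wiXn2l.
Qed.
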